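(* Let $(f_\lambda)_\lambda$ and $(g_\mu)_\mu$ be two homogeneous bases of $\Lambda$ indexed by partitions, with change of basis coefficients $A_{\lambda,\mu}$ given by $f_\lambda=\sum_{\mu\vdash|\lambda|}A_{\lambda,\mu}g_\mu$. Consider the three conditions: 1. $N^{f\to g}_{\lambda,\mu}<\infty$ for all partitions $\lambda,\mu$; 2. $|J^{f\to g}_\mu|<\infty$ for all partitions $\mu$; 3. $|I^{f\to g}_\lambda|<\infty$ for all partitions $\lambda$. Then: - finite weight transfers from $f$ to $g$ if and only if condition 3 holds; - there is weak stability transfer from $f$ to $g$ if and only if condition 1 holds; - stability transfers from $f$ to $g$ if and only if conditions 1 and 2 hold; - uniform stability transfers from $f$ to $g$ if and only if conditions 1 and 3 hold.
   Context: $\Lambda$ is the algebra of symmetric functions over $\mathbb{C}$ and $\Lambda^{(n)}$ its homogeneous part of degree $n$. A homogeneous basis indexed by partitions is a basis $(f_\lambda)_\lambda$ of $\Lambda$ with $f_\lambda\in\Lambda^{(|\lambda|)}$. For a partition $\lambda=(\lambda_1,\dots,\lambda_l)$ and $n$ with $n-|\lambda|\ge\lambda_1$ (with $\lambda_1=0$ if $\lambda=\emptyset$), $\lambda[n]:=(n-|\lambda|,\lambda_1,\dots,\lambda_l)\vdash n$; otherwise $\lambda[n]$ is undefined. Every partition of $n$ is $\lambda[n]$ for a unique $\lambda$. For a sequence $F_\bullet=(F_n)_n$ with $F_n\in\Lambda^{(n)}$, write $F_n=\sum_\lambda d_{\lambda,n}f_{\lambda[n]}$, with $d_{\lambda,n}=0$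 if $\lambda[n]$ is undefined. Let $\mathrm{rg}^f_\lambda(F_\bullet)$ be the smallest $n$ with $d_{\lambda,n}=d_{\lambda,n+k}$ for all $k\ge0$ ($\infty$ if none). $F_\bullet$ is $f$-stable if $\mathrm{rg}^f_\lambda(F_\bullet)<\infty$ for all $\lambda$. It is uniformly $f$-stable if $\mathrm{rg}^f(F_\bullet):=\max_\lambda \mathrm{rg}^f_\lambda(F_\bullet)<\infty$. The $f$-weight is $\mathrm{wt}_f(F_\bullet)=\max\{|\lambda| : \exists n,\ d_{\lambda,n}\ne0\}$ (possibly $\infty$). Stability (resp. uniform stability) transfers from $f$ to $g$ if every $f$-stable (resp. uniformly $f$-stable) sequence is $g$-stable (resp. uniformly $g$-stable). There is weak stability transfer from $f$ to $g$ if every uniformly $f$-stable sequence is $g$-stable. Finite weight transfers from $f$ to $g$ if $\mathrm{wt}_f(F_\bullet)<\infty$ implies $\mathrm{wt}_g(F_\bullet)<\infty$ for every sequence $F_\bullet$. Set $A_{\lambda[n],\mu[n]}=0$ whenever $\lambda[n]$ or $\mu[n]$ is undefined. $N^{f\to g}_{\lambda,\mu}$ is the smallest $n$ with $A_{\lambda[n],\mu[n]}=A_{\lambda[n+k],\mu[n+k]}$ for all $k\ge0$ ($\infty$ if none). $J^{f\to g}_\mu:=\{\lambda : \exists n,\ A_{\lambda[n],\mu[n]}\ne0\}$ and $I^{f\to g}_\lambda:=\{\mu : \exists n,\ A_{\lambda[n],\mu[n]}\neq0\}$. *)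

(* Defs.v *)
From HB Require Import structures.
From mathcomp Require Import all_boot all_order all_algebra finmap.
From mathcomp Require Import boolp classical_sets functions cardinality fsbigop.
From mathcomp Require Import reals constructive_ereal ereal.
From mathcomp Require Export complex.

Set Implicit Arguments.
Unset Strict Implicit.
Unset Printing Implicit Defensive.
Import Order.TTheory GRing.Theory Num.Theory.

Local Open Scope fset_scope.
Local Open Scope classical_set_scope.
Local Open Scope ring_scope.

(* Symmetric functions are the formal power series of bounded degree in the
   variables x_0, x_1, x_2, ... that are invariant under every permutation of
   the variables.  A monomial is its exponent vector, and a power series is its
   coefficient function.  The product is not defined: bases, degrees and
   coefficients only involve the graded vector space structure. *)

Definition monomial := {fsfun nat -> nat with 0%N}.

Definition mondeg (m : monomial) : nat := (\sum_(i <- finsupp m) m i)%N.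

Section SymmetricFunctions.
Variable K : fieldType.

Definition bounded_degree (F : monomial -> K^o) : Prop :=
  exists d, forall m, (d < mondeg m)%N -> F m = 0.

Definition perm_invariant (F : monomial -> K^o) : Prop :=
  forall (s : nat -> nat) (m m' : monomial),
    bijective s -> (forall i, m' i = m (s i)) -> F m' = F m.

Definition symmetric_series : {pred monomial -> K^o} :=
  fun F => `[< bounded_degree F /\ perm_invariant F >].

Lemma symmetric_series_submod : submod_closed symmetric_series.
Proof.
split=> [|a F G /asboolP[[d dF] sF] /asboolP[[e eG] sG]].
  by apply/asboolP; split; [exists 0%N|].
apply/asboolP; split=> [|s m m' bs mm'].
  exists (maxn d e) => m; rewrite gtn_max => /andP[dm em].
  by rewrite addrfctE scalrfctE dF// eG// scaler0 addr0.
by rewrite addrfctE scalrfctE (sF _ _ _ bs mm') (sG _ _ _ bs mm').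
Qed.

HB.instance Definition _ :=
  GRing.isSubmodClosed.Build K (monomial -> K^o) symmetric_series
    symmetric_series_submod.

Record symf := Symf {
  symf_series :> monomial -> K^o;
  symf_seriesP : symf_series \in symmetric_series }.

HB.instance Definition _ := [isSub for symf_series].
HB.instance Definition _ := [Choice of symf by <:].
HB.instance Definition _ := [SubChoice_isSubLmodule of symf by <:].

Definition homog (n : nat) : set symf :=
  [set F | forall m, F m != 0 -> mondeg m = n].

End SymmetricFunctions.

Section Basis.
Variables (K : fieldType) (V : lmodType K) (I : choiceType).
Implicit Types (b : I -> V) (c : {fsfun I -> K with 0}).

Definition lincomb b c : V := \sum_(i <- finsupp c) c i *: b i.

Definition is_basis b : Prop :=
  (forall c, lincomb b c = 0 -> forall i, c i = 0) /\
  (forall v, exists c, v = lincomb b c).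

(* Only meaningful when [b] is a basis. *)
Definition coord b (v : V) : {fsfun I -> K with 0} :=
  xget [fsfun] [set c | v = lincomb b c].

End Basis.

Definition is_intpart (s : seq nat) : bool := sorted geq s && (0%N \notin s).

Record intpart := IntPart { parts :> seq nat; partsP : is_intpart parts }.

HB.instance Definition _ := [isSub for parts].
HB.instance Definition _ := [Countable of intpart by <:].

Definition weight (la : intpart) : nat := sumn la.

Definition padded (la : intpart) (n : nat) : bool :=
  (weight la + head 0%N la <= n)%N.

(* The partition la[n], with [None] for undefined.  Removing zero parts only
   matters for la = empty and n = 0, where la[n] = (0) is the empty partition. *)
Definition pad (la : intpart) (n : nat) : option intpart :=
  if padded la n
  then insub [seq i <- (n - weight la)%N :: (la : seq nat) | (0 < i)%N]
  else None.

Lemma pad_def (la : intpart) (n : nat) : padded la n ->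
  exists2 p : intpart, pad la n = Some p
    & (p : seq nat) = [seq i <- (n - weight la)%N :: (la : seq nat) | (0 < i)%N].
Proof.
move=> pn; rewrite /pad pn; set s := [seq i <- _ | _].
have sP : is_intpart s.
  rewrite /is_intpart mem_filter /= andbT; apply: sorted_filter.
    by move=> a b c /= ba ac; apply: leq_trans ac ba.
  have /andP[+ _] := partsP la; move: pn; rewrite /padded.
  case: (parts la) => //= a l pn ->; rewrite andbT.
  by rewrite leq_subRL// (leq_trans (leq_addr _ _) pn).
by exists (IntPart sP) => //; rewrite (insubT _ sP); congr Some; apply: val_inj.
Qed.

Section Stability.
Variable R : realType.
Local Notation C := R[i].
Implicit Types (f g : intpart -> symf C) (F : nat -> symf C).
Implicit Types (A : intpart -> intpart -> C) (la mu : intpart).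

(* The smallest n from which u is constant: the infimum of a set of natural
   numbers is attained if the set is nonempty and is +oo if it is empty. *)
Definition stab_index (T : Type) (u : nat -> T) : \bar R :=
  ereal_inf [set n%:R%:E | n in [set n | forall k, u n = u (n + k)%N]].

Definition homog_basis f : Prop :=
  is_basis f /\ forall la, homog (weight la) (f la).

Definition homog_seq F : Prop := forall n, homog n (F n).

(* The coefficient d_{la,n} of f_{la[n]} in F_n: every partition of n is la[n]
   for a unique la. *)
Definition dcoef f F la (n : nat) : C :=
  if pad la n is Some p then coord f (F n) p else 0.

Definition rg_at f F la : \bar R := stab_index (dcoef f F la).

(* As for stab_index, the supremum is the maximum whenever it is finite. *)
Definition rg f F : \bar R := ereal_sup [set rg_at f F la | la in setT].

Definition stable f F : Prop := forall la, (rg_at f F la < +oo)%E.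

Definition unif_stable f F : Prop := (rg f F < +oo)%E.

Definition wt f F : \bar R :=
  ereal_sup [set (weight la)%:R%:E |
             la in [set la | exists n, dcoef f F la n != 0]].

Definition stability_transfers f g : Prop :=
  forall F, homog_seq F -> stable f F -> stable g F.

Definition unif_stability_transfers f g : Prop :=
  forall F, homog_seq F -> unif_stable f F -> unif_stable g F.

Definition weak_stability_transfer f g : Prop :=
  forall F, homog_seq F -> unif_stable f F -> stable g F.

Definition finite_weight_transfers f g : Prop :=
  forall F, homog_seq F -> (wt f F < +oo)%E -> (wt g F < +oo)%E.

Definition change_of_basis f g A : Prop :=
  forall la, f la = \sum_(mu \in [set mu | weight mu = weight la]) A la mu *: g mu.

Definition Apad A la mu (n : nat) : C :=
  match pad la n, pad mu n with
  | Some p, Some q => A p q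
  | _, _ => 0
  end.

Definition Nstab A la mu : \bar R := stab_index (Apad A la mu).

Definition Jset A mu : set intpart := [set la | exists n, Apad A la mu n != 0].

Definition Iset A la : set intpart := [set mu | exists n, Apad A la mu n != 0].

End Stability.

(* Main.v *)
Require Import Defs.
From mathcomp Require Import all_boot all_order all_algebra finmap.
From mathcomp Require Import boolp classical_sets cardinality fsbigop.
From mathcomp Require Import reals constructive_ereal ereal.
From mathcomp Require Import zify.

(** Write [d] and [e] for the coefficients of a homogeneous sequence [F] on
    [f] and [g].  Since padding [la |-> la[n]] is a bijection from the
    [la] for which it is defined onto the partitions of [n], the change of
    basis reads, for every [n],

      [e mu n = \sum_la d la n * Apad A la mu n]     ([dcoef_change]),

    a finite sum, and the theorem is a study of this formula.

    Sufficiency.  In each case the sum only involves [la] in a finite set that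
    does not depend on [n]: the support of [d] when the weight is finite; the
    [la] with [la[N]] defined when [d] is constant from [N] on
    ([unif_stable_expansion]), because [d la N = 0] for all the others; the set
    [Jset A mu] in general when condition 2 holds.  A finite sum of products
    of eventually constant sequences is eventually constant, and when
    finitely many [la] contribute, condition 3 leaves only finitely many [mu],
    so that the individual stabilization indices have a common bound.

    Necessity.  The sequence [F n = f la[n]] has finite weight and is uniformly
    [f]-stable, and [e mu n = Apad A la mu n]: each transfer hypothesis,
    applied to it, is a statement about row [la] of [A].  This gives
    conditions 1 and 3; for uniform transfer, condition 3 follows because
    [Apad A la mu] constant from [N] on for all [mu] forces
    [weight mu <= N] on its support.  For condition 2, choose for each [la] in
    [Jset A mu] an index [t la] with [Apad A la mu (t la) != 0], and let [F n]
    be a multiple of [f la[n]] for one [la] such that [t la = n], or 0 if there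
    is none.  Each [la] is used at most once, so [F] is [f]-stable, and
    scaling makes [e mu (t la) = t la] on [Jset A mu].  Stability of [e mu]
    then bounds [t], hence the weights, on [Jset A mu]
    ([stability_transfer_Jset]). *)

Set Implicit Arguments.
Unset Strict Implicit.
Unset Printing Implicit Defensive.
Import Order.TTheory GRing.Theory Num.Theory.
Local Open Scope classical_set_scope.
Local Open Scope ring_scope.
Local Notation coord := Defs.coord.

(** * Partitions and padding *)

Lemma size_le_weight (la : intpart) : (size la <= weight la)%N.
Proof.
have /andP[_] := partsP la; rewrite /weight.
elim: (parts la) => //= a s ih.
rewrite inE negb_or eq_sym -lt0n => /andP[a0 /ih].
by rewrite -add1n; exact: leq_add.
Qed.

Lemma leq_part_weight (la : intpart) i :
  i \in (la : seq nat) -> (i <= weight la)%N.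
Proof.
rewrite /weight; elim: (parts la) => //= a s ih.
rewrite inE => /orP[/eqP->|/ih /leq_trans]; first exact: leq_addr.
by apply; exact: leq_addl.
Qed.

(** A partition of weight at most [N] has at most [N] parts, each at most [N]:
    these partitions are the images of finitely many bounded sequences. *)
Lemma finite_weight_le N : finite_set [set la | (weight la <= N)%N].
Proof.
pose h (s : N.-bseq 'I_N.+1) : option intpart :=
  insub (map (@nat_of_ord _) (s : seq _)).
have fin : finite_set (Some @^-1` range h).
  apply: finite_preimage; last exact/finite_image/finite_finset.
  by move=> x y _ _ [].
apply: sub_finite_set fin => la /= laN.
have sN : (size [seq inord i : 'I_N.+1 | i <- (la : seq nat)] <= N)%N.
  by rewrite size_map (leq_trans (size_le_weight la)).
exists (Bseq sN) => //; rewrite /h /= -map_comp map_id_in.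
  by rewrite valK.
move=> i /leq_part_weight ila /=; rewrite inordK// ltnS.
exact: leq_trans laN.
Qed.

(** The inverse of padding: [p = (unpad p)[n]] for [p] a partition of [n].
    The default value of [insubd] is never reached ([val_unpad]). *)
Definition unpad (p : intpart) : intpart := insubd p (behead p).

Lemma val_unpad (p : intpart) : (unpad p : seq nat) = behead p.
Proof.
apply: insubdK; have /andP[] := partsP p; rewrite /is_intpart unfold_in.
case: (parts p) => //= a s /path_sorted -> /=.
by rewrite inE negb_or => /andP[].
Qed.

Lemma weight_unpad (p : intpart) : (head 0%N p + weight (unpad p) = weight p)%N.
Proof. by rewrite /weight val_unpad; case: (parts p). Qed.

Lemma filter_parts (la : intpart) : [seq i <- (la : seq nat) | (0 < i)%N] = la.
Proof.
apply/all_filterP/allP => i ila; rewrite lt0n; apply: contraTneq ila => ->.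
by have /andP[] := partsP la.
Qed.

Lemma pad_Some la n p : pad la n = Some p -> la = unpad p /\ weight p = n.
Proof.
have [pn|] := boolP (padded la n); last by rewrite /pad => /negPf->.
have [p' -> E] := pad_def pn => -[<-]; move: E pn.
rewrite /padded /= filter_parts; case: posnP => [n0 E pn|n0 E pn].
  (* The added part is 0: then la has no part, and n = 0. *)
  have h0 : head 0%N la = 0%N by move: n0 pn; lia.
  have la0 : (la : seq nat) = [::].
    have /andP[_] := partsP la; move: h0; case: (parts la) => //= a s ->.
    by rewrite inE eqxx.
  have w0 : weight la = 0%N by rewrite /weight la0.
  split; first by apply: val_inj; rewrite /= val_unpad E la0.
  by rewrite /weight E la0 /=; move: n0; rewrite w0 subn0.
split; first by apply: val_inj; rewrite /= val_unpad E.
by rewrite {1}/weight E /= subnK// ltnW// -subn_gt0.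
Qed.

Lemma pad_unpad p : pad (unpad p) (weight p) = Some p.
Proof.
have wE := weight_unpad p.
have pn : padded (unpad p) (weight p).
  rewrite /padded -wE addnC leq_add2r val_unpad.
  have /andP[] := partsP p; case: (parts p) => [|a [|b s]] //= /andP[+ _] _.
  by [].
have [p' -> E] := pad_def pn; congr Some; apply: val_inj; rewrite /= E /=.
rewrite -wE addnK filter_parts val_unpad.
have /andP[_] := partsP p; case: (parts p) => //= a s.
by rewrite inE negb_or eq_sym -lt0n => /andP[->].
Qed.

Lemma unpad_inj n : {in [pred p | weight p == n] &, injective unpad}.
Proof.
move=> p q; rewrite !inE => /eqP pn /eqP qn pq; apply: Some_inj.
by rewrite -(pad_unpad p) -(pad_unpad q) pn qn pq.
Qed.

(** * Coordinates in a basis *)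

Section Coordinates.
Variables (K : fieldType) (V : lmodType K) (I : choiceType) (b : I -> V).
Hypothesis hb : is_basis b.

Lemma lincomb_coord v : lincomb b (coord b v) = v.
Proof.
have [c vc] := hb.2 v.
exact/esym/(@xgetPex _ [fsfun] [set c | v = lincomb b c])/(ex_intro _ c).
Qed.

Lemma lincomb_fsub (c : {fsfun I -> K with 0}) (S : {fset I}) :
  (finsupp c `<=` S)%fset -> lincomb b c = \sum_(i <- S) c i *: b i.
Proof.
move=> cS; apply: big_fset_incl => // i _; rewrite memNfinsupp => /eqP->.
by rewrite scale0r.
Qed.

(** The difference between the actual and the expected coordinates is the
    coefficient vector of a linear relation. *)
Lemma coord_sum (S : {fset I}) (E : I -> K) i :
  coord b (\sum_(j <- S) E j *: b j) i = if i \in S then E i else 0.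
Proof.
set v := \sum_(_ <- _) _; set c := coord b v.
pose d : {fsfun I -> K with 0} :=
  [fsfun j in (finsupp c `|` S)%fset => c j - if j \in S then E j else 0].
have dE j : d j = c j - if j \in S then E j else 0.
  rewrite fsfunE inE; have [//|] := boolP (j \in finsupp c).
  rewrite memNfinsupp => /eqP->; case: (boolP (j \in S)) => //=.
  by rewrite subr0.
have /hb.1 : lincomb b d = 0.
  rewrite (@lincomb_fsub d ((finsupp c `|` S)%fset)); last first.
    apply/fsubsetP => j; rewrite mem_finsupp fsfunE.
    by case: ifP; rewrite ?eqxx.
  under eq_bigr do rewrite dE scalerBl.
  rewrite sumrB -(@lincomb_fsub c) ?fsubsetUl// lincomb_coord; apply/eqP.
  rewrite subr_eq0; apply/eqP; rewrite /v.
  under [RHS]eq_bigr do rewrite (fun_if (fun x => x *: _)) scale0r.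
  rewrite -[RHS](@big_fset_incl _ _ _ _ S) ?fsubsetUr//.
    by apply: eq_big_seq => j ->.
  by move=> j _ /negPf->.
by move=> /(_ i); rewrite dE => /eqP; rewrite subr_eq0 => /eqP.
Qed.

Lemma coord_scale (a : K) j i : coord b (a *: b j) i = if i == j then a else 0.
Proof.
have := coord_sum [fset j]%fset (fun=> a) i; rewrite big_seq_fset1 => ->.
by rewrite inE.
Qed.

End Coordinates.

Section SymmetricFunctions.
Variable K : fieldType.
Implicit Types b : intpart -> symf K.

Lemma symf_sumE (T : Type) (r : seq T) (P : pred T) (F : T -> symf K) m :
  (\sum_(i <- r | P i) F i : symf K) m = \sum_(i <- r | P i) F i m.
Proof. by elim/big_rec2: _ => // i y1 y2 _ <-. Qed.

(** The part of the expansion of [v] supported on basis elements of degree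
    other than [n] vanishes on every monomial: in degree [n] because those basis
    elements do, in other degrees because [v] and the rest of its expansion do.
    Independence then kills its coefficients. *)
Lemma coord_homog b n v p :
  is_basis b -> (forall la, homog (weight la) (b la)) -> homog n v ->
  weight p != n -> coord b v p = 0.
Proof.
move=> bB bH vn pn; have vE := lincomb_coord bB v; set c := coord b v in vE *.
pose S := [fset p in finsupp c | weight p != n]%fset.
have S0 : \sum_(i <- S) c i *: b i = 0.
  have b0 i m : weight i != mondeg m -> b i m = 0.
    by move=> im; apply: contraNeq im => /bH->.
  have SE m : \sum_(i <- S) (c i *: b i) m =
      \sum_(i <- finsupp c | weight i != n) c i * b i m.
    by rewrite big_fset /=; apply: eq_bigl => i.
  apply: val_inj; apply/funext => m; rewrite /= symf_sumE SE.
  have [mn|mn] := eqVneq (mondeg m) n.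
    by rewrite big1// => i; rewrite -mn => /b0->; rewrite mulr0.
  transitivity (v m); last by apply: contraNeq mn => /vn->.
  rewrite -vE /lincomb symf_sumE big_mkcond /=; apply: eq_bigr => i _.
  case: ifPn => // /negPn/eqP in_.
  by rewrite (_ : _ m = c i * b i m)// b0 ?mulr0// in_ eq_sym.
have := coord_sum bB S c p; rewrite S0 !inE pn andbT.
case: ifPn => [_ <-|]; last by rewrite memNfinsupp => /eqP.
by have := coord_scale bB 0 p p; rewrite scale0r eqxx.
Qed.

End SymmetricFunctions.

(** * Stabilization *)

Definition const_from (T : Type) (u : nat -> T) (N : nat) :=
  forall n, (N <= n)%N -> u n = u N.

Lemma const_fromW (T : Type) (u : nat -> T) N N' :
  (N <= N')%N -> const_from u N -> const_from u N'.
Proof.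
by move=> NN' uN n N'n; rewrite (uN n (leq_trans NN' N'n)) -(uN N' NN').
Qed.

Lemma const_from_add (T : Type) (u : nat -> T) N :
  (forall k, u N = u (N + k)%N) <-> const_from u N.
Proof.
split=> uN => [n Nn|k]; first by rewrite -(subnKC Nn).
by rewrite [RHS]uN// leq_addr.
Qed.

Lemma const_from_finite (I : choiceType) (T : Type) (u : I -> nat -> T)
    (S : {fset I}) :
  (forall i, i \in S -> exists N, const_from (u i) N) ->
  exists N, forall i, i \in S -> const_from (u i) N.
Proof.
move=> uS.
have /boolp.choice[h hP] : forall i, exists N, i \in S -> const_from (u i) N.
  by move=> i; have [/uS[N uN]|_] := boolP (i \in S); [exists N|exists 0%N].
exists (\max_(i <- S) h i)%N => i iS; apply: const_fromW (hP i iS).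
exact: leq_bigmax_seq.
Qed.

Lemma lty_nat (R : realType) (x : \bar R) :
  (x < +oo)%E -> exists N : nat, (x < N%:R%:E)%E.
Proof.
case: x => [x _| |_]; [|by []|by exists 0%N; exact: ltNyr].
exists (Num.bound `|x|); rewrite lte_fin; apply: le_lt_trans (ler_norm x) _.
exact: archi_boundP.
Qed.

Lemma stab_index_lt (R : realType) (T : Type) (u : nat -> T) N :
  (stab_index R u < N%:R%:E)%E -> const_from u N.
Proof.
move=> /ereal_inf_lt[_ [n /const_from_add un <-]].
by rewrite lte_fin ltr_nat => /ltnW/const_fromW; apply.
Qed.

Lemma stab_index_le (R : realType) (T : Type) (u : nat -> T) N :
  const_from u N -> (stab_index R u <= N%:R%:E)%E.
Proof. by move=> /const_from_add uN; apply: ereal_inf_lbound; exists N. Qed.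

Lemma stab_indexP (R : realType) (T : Type) (u : nat -> T) :
  (stab_index R u < +oo)%E <-> exists N, const_from u N.
Proof.
split=> [/lty_nat[N /stab_index_lt uN]|[N uN]]; first by exists N.
exact: le_lt_trans (stab_index_le R uN) (ltry _).
Qed.

(** Each bound on the weight leaves finitely many partitions. *)
Lemma finite_weight_sup (R : realType) (X : set intpart) :
  (ereal_sup [set (weight la)%:R%:E | la in X] < +oo :> \bar R)%E <->
  finite_set X.
Proof.
split=> [/lty_nat[N XN]|fX].
  apply: sub_finite_set (finite_weight_le N) => la Xla /=.
  rewrite ltnW// -(ltr_nat R) -lte_fin; apply: le_lt_trans XN.
  by apply: ereal_sup_ubound; exists la.
apply: (@le_lt_trans _ _ (\max_(la <- fset_set X) weight la)%N%:R%:E).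
  apply: ge_ereal_sup => _ [la Xla <-]; rewrite lee_fin ler_nat.
  by apply: leq_bigmax_seq; rewrite // in_fset_set// inE.
exact: ltry.
Qed.

Section Sequences.
Variable R : realType.
Local Notation C := R[i].
Implicit Types (f g : intpart -> symf C) (F : nat -> symf C).
Implicit Types (A : intpart -> intpart -> C) (la mu : intpart).

Lemma unif_stableP f F :
  unif_stable f F <-> exists N, forall la, const_from (dcoef f F la) N.
Proof.
split=> [/lty_nat[N FN]|[N FN]].
  exists N => la; apply: (@stab_index_lt R); apply: le_lt_trans FN.
  by apply: ereal_sup_ubound; exists la.
apply: (@le_lt_trans _ _ N%:R%:E); last exact: ltry.
by apply: ge_ereal_sup => _ [la _ <-]; exact: stab_index_le.
Qed.

Lemma stableP f F :
  stable f F <-> forall la, exists N, const_from (dcoef f F la) N.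
Proof. by split=> FN la; have := FN la; rewrite /rg_at stab_indexP. Qed.

Lemma finite_wtP f F :
  (wt f F < +oo)%E <-> finite_set [set la | exists n, dcoef f F la n != 0].
Proof. exact: finite_weight_sup. Qed.

Lemma unif_stableW f F : unif_stable f F -> stable f F.
Proof. by move=> /unif_stableP[N FN]; apply/stableP => la; exists N. Qed.

Lemma padded_weight la n : padded la n -> (weight la <= n)%N.
Proof. exact/leq_trans/leq_addr. Qed.

Lemma padded_dcoef f F la n : dcoef f F la n != 0 -> padded la n.
Proof. by rewrite /dcoef /pad; case: ifP => //; rewrite eqxx. Qed.

Lemma padded_Apadl A la mu n : Apad A la mu n != 0 -> padded la n.
Proof. by rewrite /Apad /pad; case: ifP => //; rewrite eqxx. Qed.

Lemma padded_Apadr A la mu n : Apad A la mu n != 0 -> padded mu n.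
Proof.
rewrite /Apad; case: (pad la n) => [p|]; last by rewrite eqxx.
by rewrite /pad; case: ifP => //; rewrite eqxx.
Qed.

Lemma finite_weight_eq n : finite_set [set p | weight p = n].
Proof. by apply: sub_finite_set (finite_weight_le n) => p /= ->. Qed.

(** * Change of basis for padded indices *)

Section ChangeOfBasis.
Variables (f g : intpart -> symf C) (A : intpart -> intpart -> C).
Hypotheses (hf : homog_basis f) (hg : homog_basis g).
Hypothesis hA : change_of_basis f g A.

Local Notation P n := (fset_set [set p | weight p = n]).

Lemma mem_weight_eq p n : (p \in P n) = (weight p == n).
Proof.
rewrite in_fset_set; last exact: finite_weight_eq.
by apply/idP/eqP; rewrite inE.
Qed.

Lemma coord_change n v q : homog n v -> weight q = n ->
  coord g v q = \sum_(p <- P n) coord f v p * A p q.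
Proof.
move=> vn qn; set c := coord f v.
have -> : v = \sum_(r <- P n) (\sum_(p <- P n) c p * A p r) *: g r.
  transitivity (\sum_(p <- P n) c p *: f p).
    rewrite -[LHS](lincomb_coord hf.1); apply: lincomb_fsub.
    apply/fsubsetP => p; rewrite mem_finsupp mem_weight_eq.
    by apply: contraNT => /(coord_homog hf.1 hf.2 vn)->.
  under [RHS]eq_bigr do rewrite scaler_suml.
  rewrite exchange_big /=; apply: eq_big_seq => p.
  rewrite mem_weight_eq => /eqP pn.
  rewrite hA fsbig_finite pn; last exact: finite_weight_eq.
  by rewrite scaler_sumr; apply: eq_bigr => r _; rewrite scalerA.
by rewrite (coord_sum hg.1) mem_weight_eq qn eqxx.
Qed.

(** The expansion of [F n] is indexed by partitions of [n], which [unpad] turns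
    into the unpadded indices.  The set [S] only has to contain the indices of
    nonzero terms, so that it can be chosen independently of [n]. *)
Lemma dcoef_change F (S : {fset intpart}) mu n : homog n (F n) ->
  (forall la, dcoef f F la n != 0 -> Apad A la mu n != 0 -> la \in S) ->
  dcoef g F mu n = \sum_(la <- S) dcoef f F la n * Apad A la mu n.
Proof.
move=> Fn FS; pose h la := dcoef f F la n * Apad A la mu n.
have h0 la : la \notin S -> h la = 0.
  move=> laS; apply/eqP; apply: contraNT laS; rewrite mulf_eq0 negb_or.
  by move=> /andP[]; exact: FS.
pose L := [fset unpad p | p in P n]%fset.
transitivity (\sum_(la <- L) h la).
  have hn : {in P n &, injective unpad}.
    move=> p q; rewrite !mem_weight_eq => pn qn; exact: (@unpad_inj n).
  rewrite big_imfset //= {1}/dcoef.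
  case q_ : (pad mu n) => [q|]; last first.
    rewrite big1// => p _.
    by rewrite /h /Apad q_; case: (pad _ _) => [_|]; rewrite mulr0.
  have [_ qn] := pad_Some q_.
  rewrite (coord_change Fn qn); apply: eq_big_seq => p.
  rewrite mem_weight_eq => /eqP pn.
  by rewrite /h /dcoef /Apad q_ -pn pad_unpad pn.
have hL la : la \notin L -> h la = 0.
  move=> laL; rewrite /h /dcoef.
  case p_ : (pad la n) => [p|]; last by rewrite mul0r.
  have [lap pn] := pad_Some p_; move: laL; rewrite lap in_imfset//=.
  by rewrite mem_weight_eq pn.
transitivity (\sum_(la <- (L `|` S)%fset) h la).
  by apply: big_fset_incl => [|la _]; [exact: fsubsetUl|exact: hL].
by apply/esym/big_fset_incl => [|la _]; [exact: fsubsetUr|exact: h0].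
Qed.

(** Sequences with at most one term in each degree, the test sequences of
    every necessity argument. *)
Definition one_term (x : nat -> C) (l : nat -> intpart) (n : nat) : symf C :=
  if pad (l n) n is Some p then x n *: f p else 0.

Lemma homog_one_term x l : homog_seq (one_term x l).
Proof.
move=> n m; rewrite /one_term; case E: (pad _ _) => [p|]; last by rewrite eqxx.
have [_ wp] := pad_Some E.
move=> xm; rewrite -wp; apply: (hf.2 p); apply: contra_neq xm => fm.
by rewrite -[LHS]/(x n * f p m) fm mulr0.
Qed.

Lemma dcoef_one_term x l la n :
  dcoef f (one_term x l) la n = if (la == l n) && padded la n then x n else 0.
Proof.
rewrite /dcoef; have [pn|/negPf pn] := boolP (padded la n); last first.
  by rewrite /pad pn andbF.
have [p E _] := pad_def pn; rewrite E andbT /one_term.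
case E' : (pad (l n) n) => [q|].
  rewrite (coord_scale hf.1); congr (if _ then _ else _).
  have [-> wp] := pad_Some E; have [-> wq] := pad_Some E'.
  apply/eqP/eqP => [->//|]; apply: (@unpad_inj n); rewrite inE; exact/eqP.
have [ll|] := eqVneq la (l n); first by rewrite -ll E in E'.
by have := coord_scale hf.1 0 p p; rewrite scale0r eqxx.
Qed.

Lemma dcoef_change_one_term x l mu n :
  dcoef g (one_term x l) mu n = x n * Apad A (l n) mu n.
Proof.
rewrite (@dcoef_change _ [fset l n]%fset); first last.
- move=> la; rewrite dcoef_one_term inE.
  by case: (la == l n) => //=; rewrite eqxx.
- exact: homog_one_term.
rewrite big_seq_fset1 dcoef_one_term eqxx /=.
have [A0|/padded_Apadl->//] := eqVneq (Apad A (l n) mu n) 0.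
by rewrite A0 !mulr0.
Qed.

Let single la := one_term (fun=> 1) (fun=> la).

Lemma dcoef_single la mu n : dcoef g (single la) mu n = Apad A la mu n.
Proof. by rewrite dcoef_change_one_term mul1r. Qed.

Lemma unif_stable_single la : unif_stable f (single la).
Proof.
apply/unif_stableP; exists (weight la + head 0%N la)%N => mu n Nn.
rewrite !dcoef_one_term; case: eqP => //= ->.
by rewrite /padded leqnn Nn.
Qed.

Lemma finite_wt_single la : (wt f (single la) < +oo)%E.
Proof.
apply/finite_wtP; apply: sub_finite_set (finite_set1 la) => mu [n].
by rewrite dcoef_one_term; have [->//|_] := eqVneq mu la; rewrite eqxx.
Qed.

(** * The four transfer criteria *)

Lemma weak_transfer_Nstab : weak_stability_transfer f g ->
  forall la mu, (Nstab A la mu < +oo)%E.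
Proof.
move=> tr la mu; apply/(stab_indexP R).
have /stableP/(_ mu)[N gN] :=
  tr _ (@homog_one_term _ _) (unif_stable_single la).
by exists N => n /gN; rewrite !dcoef_single.
Qed.

(** Uniform stability from [N] on bounds the support: only the
    [la] with [la[N]] defined, whose weight is at most [N], can have a nonzero
    coefficient at [N], and hence at any later [n]. *)
Lemma unif_stable_expansion F N mu n : homog_seq F ->
  (forall la, const_from (dcoef f F la) N) -> (N <= n)%N ->
  dcoef g F mu n =
  \sum_(la <- fset_set [set la | (weight la <= N)%N])
     dcoef f F la N * Apad A la mu n.
Proof.
move=> hF FN Nn.
rewrite (@dcoef_change F (fset_set [set la | (weight la <= N)%N]))//.
  by apply: eq_bigr => la _; rewrite (FN la n Nn).
move=> la; rewrite (FN la n Nn) => /padded_dcoef/padded_weight laN _.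
by rewrite in_fset_set ?inE//; exact: finite_weight_le.
Qed.

Lemma finite_weight_transferP : finite_weight_transfers f g <->
  forall la, finite_set (Iset A la).
Proof.
split=> [tr la|I_fin F hF /finite_wtP fF].
  have := tr _ (@homog_one_term _ _) (finite_wt_single la).
  move=> /finite_wtP; apply: sub_finite_set => mu [n An].
  by exists n; rewrite dcoef_single.
apply/finite_wtP.
apply: sub_finite_set (bigcup_finite fF (fun la _ => I_fin la)) => mu [n].
rewrite (@dcoef_change F (fset_set [set la | exists n, dcoef f F la n != 0]))//;
  last first.
  by move=> la Fla _; rewrite in_fset_set// inE; exists n.
apply: contraNP => muI; apply/eqP; rewrite big1_seq// => la.
rewrite in_fset_set// inE /= => Fla.
have [->|An] := eqVneq (Apad A la mu n) 0; first by rewrite mulr0.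
by exfalso; apply: muI; exists la => //; exists n.
Qed.

Lemma weak_stability_transferP : weak_stability_transfer f g <->
  forall la mu, (Nstab A la mu < +oo)%E.
Proof.
split=> [/weak_transfer_Nstab//|hN F hF /unif_stableP[N FN]].
apply/stableP => mu.
have [N' AN'] := @const_from_finite _ _ (fun la => Apad A la mu)
  (fset_set [set la | (weight la <= N)%N])
  (fun la _ => (stab_indexP R _).1 (hN la mu)).
exists (maxn N N') => n; rewrite geq_max => /andP[Nn N'n].
rewrite !(unif_stable_expansion _ hF FN) ?leq_maxl//.
apply: eq_big_seq => la laS; congr (_ * _).
by rewrite (AN' la laS n N'n) -(AN' la laS (maxn N N')) ?leq_maxr.
Qed.

(** The test sequence uses each [la] at the single index [t la], whence its
    [f]-stability, and has [g]-coefficient [n] at [mu] in each degree [n] in the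
    image of [t]: these coefficients can be eventually constant only if [t] is
    bounded on [Jset A mu]. *)
Lemma stability_transfer_Jset : stability_transfers f g ->
  forall mu, finite_set (Jset A mu).
Proof.
move=> tr mu.
pose t la := xget 0%N [set n | Apad A la mu n != 0].
have tP la : Jset A mu la -> Apad A la mu (t la) != 0.
  move=> [n An]; apply: (@xgetPex _ 0%N [set n | Apad A la mu n != 0]).
  by exists n.
pose l n := xget mu [set la | Jset A mu la /\ t la = n].
(* The test discards the n outside the image of t, where l n is a default. *)
pose x n := if t (l n) == n then n%:R / Apad A (l n) mu n else 0.
pose F := one_term x l.
have Ft la : Jset A mu la -> dcoef g F mu (t la) = (t la)%:R.
  move=> Jla; have [Jl tl] : Jset A mu (l (t la)) /\ t (l (t la)) = t la.
    apply: (@xgetPex _ mu [set la' | Jset A mu la' /\ t la' = t la]).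
    by exists la.
  rewrite dcoef_change_one_term /x tl eqxx divfK//.
  by have := tP _ Jl; rewrite tl.
have : stable g F.
  apply: tr; first exact: homog_one_term.
  apply/stableP => la; exists (t la).+1.
  have F0 n : (t la < n)%N -> dcoef f F la n = 0.
    move=> tn; rewrite dcoef_one_term; case: eqP => //= ll.
    by rewrite /x -ll ltn_eqF// if_same.
  by move=> n tn; rewrite !F0.
move=> /stableP/(_ mu)[N FN].
have const_t la la' : Jset A mu la -> Jset A mu la' ->
    (N <= t la)%N -> (N <= t la')%N -> t la' = t la.
  move=> Jla Jla' Nla Nla'; apply/eqP; rewrite -(eqr_nat C).
  by rewrite -(Ft _ Jla) -(Ft _ Jla') (FN _ Nla) (FN _ Nla').
have [M JM] : exists M, forall la, Jset A mu la -> (t la <= M)%N.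
  have [[la [Jla Nla]]|noN] :=
    pselect (exists la, Jset A mu la /\ (N <= t la)%N).
    exists (t la) => la' Jla'; have [Nla'|/ltnW ltN] := leqP N (t la').
      by rewrite (const_t la la').
    exact: leq_trans ltN Nla.
  exists N => la Jla; apply/ltnW; rewrite ltnNge; apply/negP => Nla.
  by apply: noN; exists la.
apply: sub_finite_set (finite_weight_le M) => la Jla /=.
apply: leq_trans (JM la Jla); exact/padded_weight/padded_Apadl/(tP la Jla).
Qed.

Lemma stability_transferP : stability_transfers f g <->
  (forall la mu, (Nstab A la mu < +oo)%E) /\
  (forall mu, finite_set (Jset A mu)).
Proof.
split=> [tr|[hN hJ] F hF /stableP FS].
  split; last exact: stability_transfer_Jset.
  by apply: weak_transfer_Nstab => F hF /unif_stableW; exact: tr.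
apply/stableP => mu; set S := fset_set (Jset A mu).
have [N FN] := @const_from_finite _ _ (dcoef f F) S (fun la _ => FS la).
have [N' AN] := @const_from_finite _ _ (fun la => Apad A la mu) S
  (fun la _ => (stab_indexP R _).1 (hN la mu)).
have FE n : dcoef g F mu n = \sum_(la <- S) dcoef f F la n * Apad A la mu n.
  by apply: dcoef_change => // la _ An; rewrite in_fset_set// inE; exists n.
exists (maxn N N') => n Mn; rewrite !FE; apply: eq_big_seq => la laS.
rewrite (const_fromW (leq_maxl N N') (FN la laS))//.
by rewrite (const_fromW (leq_maxr N N') (AN la laS)).
Qed.

Lemma unif_stability_transferP : unif_stability_transfers f g <->
  (forall la mu, (Nstab A la mu < +oo)%E) /\
  (forall la, finite_set (Iset A la)).
Proof.
split=> [tr|[hN hI] F hF hu].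
  split; first by apply: weak_transfer_Nstab => F hF /(tr F hF)/unif_stableW.
  move=> la; have := tr _ (@homog_one_term _ _) (unif_stable_single la).
  move=> /unif_stableP[N gN].
  apply: sub_finite_set (finite_weight_le N) => mu [n An] /=.
  (* Before N, padding bounds the weight; later, the entry is that at N. *)
  have [nN|/ltnW Nn] := leqP n N.
    exact: leq_trans (padded_weight (padded_Apadr An)) nN.
  apply/padded_weight/(@padded_Apadr A la).
  by rewrite -dcoef_single -(gN mu n Nn) dcoef_single.
have gS : stable g F by apply: (weak_stability_transferP.2 hN).
have [N FN] := (unif_stableP _ _).1 hu.
set S := [set la | (weight la <= N)%N].
have fT : finite_set (\bigcup_(la in S) Iset A la).
  by apply: bigcup_finite => //; exact: finite_weight_le.
(* Outside this finite set of mu, all the products in the expansion vanish. *)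
have [N' gN'] := const_from_finite (S := fset_set (\bigcup_(la in S) Iset A la))
  (fun mu _ => (stableP _ _).1 gS mu).
apply/unif_stableP; exists (maxn N N') => mu.
have [muT|muT] := pselect ((\bigcup_(la in S) Iset A la) mu).
  apply: (const_fromW (leq_maxr N N')); apply: gN'.
  by rewrite in_fset_set// inE.
have g0 n : (N <= n)%N -> dcoef g F mu n = 0.
  move=> Nn; rewrite (unif_stable_expansion _ hF FN Nn) big1_seq// => la.
  rewrite in_fset_set ?inE => [/= laS|]; last exact: finite_weight_le.
  have [->|An] := eqVneq (Apad A la mu n) 0; first by rewrite mulr0.
  by exfalso; apply: muT; exists la => //; exists n.
apply: (const_fromW (leq_maxl N N')) => n Nn.
by rewrite !g0.
Qed.

End ChangeOfBasis.

End Sequences.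

Theorem theorem3p0p1 (R : realType) (f g : intpart -> symf R[i])
    (A : intpart -> intpart -> R[i])
    (hf : homog_basis f) (hg : homog_basis g) (hA : change_of_basis f g A) :
  let cond1 := forall la mu : intpart, (Nstab A la mu < +oo)%E in
  let cond2 := forall mu : intpart, finite_set (Jset A mu) in
  let cond3 := forall la : intpart, finite_set (Iset A la) in
  [/\ finite_weight_transfers f g <-> cond3,
      weak_stability_transfer f g <-> cond1,
      stability_transfers f g <-> cond1 /\ cond2
    & unif_stability_transfers f g <-> cond1 /\ cond3].
Proof.
split.
- exact: finite_weight_transferP.
- exact: weak_stability_transferP.
- exact: stability_transferP.
- exact: unif_stability_transferP.
Qed.
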